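(* $3/2\leq C^*\leq 6.614$.
   Context: Every Boolean function $f:\{0,1\}^n\to\{0,1\}$ has a unique multilinear representation over $\mathbb{R}$ agreeing with $f$ on $\{0,1\}^n$; $\deg(f)$ is its degree. A variable is relevant if it appears in a monomial with nonzero coefficient; $R(f)$ is the number of relevant variables. $R_d$ is the maximum of $R(f)$ over Boolean functions of degree at most $d$, $C_d=R_d2^{-d}$, and $C^*=\lim_{d\to\infty}C_d$ (the sequence $C_d$ is nondecreasing). *)

(* Defs.v *)
From HB Require Import structures.
From mathcomp Require Import all_boot all_order all_algebra.
From mathcomp Require Import all_classical all_reals all_analysis.
Set Implicit Arguments. Unset Strict Implicit. Unset Printing Implicit Defensive.
Import Order.TTheory GRing.Theory Num.Theory.
Local Open Scope ring_scope.

Definition boolfun (n : nat) := {ffun 'I_n -> bool} -> bool.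

(* c : {set 'I_n} -> R is the coefficient family of a multilinear polynomial
   sum_S c_S prod_{i in S} x_i over R; it represents f if it agrees with f
   on {0,1}^n.  (Such a representation exists and is unique.) *)
Definition mlrep (R : realType) (n : nat) (f : boolfun n) (c : {set 'I_n} -> R) : Prop :=
  forall x : {ffun 'I_n -> bool},
    ((f x)%:R : R) = \sum_(S : {set 'I_n}) c S * \prod_(i in S) ((x i)%:R : R).

Definition deg_le (R : realType) (n : nat) (f : boolfun n) (d : nat) : Prop :=
  exists c : {set 'I_n} -> R, mlrep f c /\ forall S, c S != 0 -> (#|S| <= d)%N.

Definition relevant (R : realType) (n : nat) (f : boolfun n) (i : 'I_n) : Prop :=
  exists c : {set 'I_n} -> R, mlrep f c /\ exists S : {set 'I_n}, i \in S /\ c S != 0.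

Definition nrel (R : realType) (n : nat) (f : boolfun n) : nat :=
  #|[set i : 'I_n | `[< relevant R f i >] ]|.

Definition is_Rd (R : realType) (d r : nat) : Prop :=
  (exists (n : nat) (f : boolfun n), deg_le R f d /\ nrel R f = r) /\
  (forall (n : nat) (f : boolfun n), deg_le R f d -> (nrel R f <= r)%N).

(* Main.v *)
(* Upper bound.  Give a relevant variable [i] the weight [2 ^ - deg_i], where [deg_i] is the
   largest degree of a monomial containing [i], so that [R(f) / 2 ^ d] is at most the total
   weight [W(f)].  Weights do not decrease on average when other variables are fixed.  Fixing
   all variables but [i] gives [W(f) <= d / 2] through the total influence.  Fixing instead a
   set [H] that meets every monomial of degree [d] lowers the degree, hence
   [W_d <= W_(d-1) + |H| / 2 ^ d].  The union of a maximal family of disjoint monomials of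
   degree [d] is such an [H], and there are at most [d ^ 2] of them: identify the variables of
   each block, so that the function becomes sensitive to every block at [0], and apply Markov's
   inequality at the endpoint [0] to [q |-> E f], each variable being [1] with probability [q];
   the derivative of this polynomial at [0] counts the blocks.  Thus [|H| <= d ^ 3], and summing
   from [d = 11] on gives [11 / 2 + 2281 / 2048 <= 6.614].

   Lower bound.  Selecting between two copies of [f] by the equality of two fresh bits, and
   adding one of these bits to the result, gives [R_(d+1) >= 2 R_d + 2]. *)
Require Import Defs.
From HB Require Import structures.
From mathcomp Require Import all_boot all_order all_algebra.
From mathcomp Require Import all_classical all_reals all_analysis.
(* [fintype] and [finset] again, as the classical sets shadow [set0], [subsetP], etc. *)
From mathcomp Require Import fintype finset ring lra zify.
Set Implicit Arguments. Unset Strict Implicit. Unset Printing Implicit Defensive.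
Import Order.TTheory GRing.Theory Num.Theory numFieldNormedType.Exports.
Local Open Scope ring_scope.

(** * Multilinear polynomials as coefficient families, and restriction of one variable *)

(* A point of the cube is identified with the set [X] of its ones. *)
Definition ev (R : realFieldType) (T : finType) (c : {set T} -> R) (X : {set T}) : R :=
  \sum_(S : {set T} | S \subset X) c S.

Definition coef_deg_le (R : realFieldType) (T : finType) (c : {set T} -> R) (d : nat) :=
  forall S, c S != 0 -> (#|S| <= d)%N.

Definition bool_valued (R : realFieldType) (T : finType) (g : {set T} -> R) :=
  forall X, g X = 0 \/ g X = 1.

(** Uniqueness of the multilinear representation, by induction on [#|S|]: the value at [S] is [c S]
    plus coefficients of proper subsets, already known to agree. *)
Lemma ev_inj (R : realFieldType) (T : finType) (c c' : {set T} -> R) :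
  ev c =1 ev c' -> c =1 c'.
Proof.
move=> evE S; elim/ltn_ind: #|S| {-2}S (erefl #|S|) => m IH {}S cardS.
move: (evE S); rewrite /ev (bigD1 S) // [in X in _ = X -> _](bigD1 S) //=.
suff -> : \sum_(A : {set T} | (A \subset S) && (A != S)) c A =
          \sum_(A : {set T} | (A \subset S) && (A != S)) c' A by move/addIr.
apply: eq_bigr => A /andP[sAS nAS]; apply: (IH #|A|) => //.
by rewrite -cardS proper_card // properEneq nAS.
Qed.

Lemma ev_set0 (R : realFieldType) (T : finType) (c : {set T} -> R) : ev c set0 = c set0.
Proof.
rewrite /ev (bigD1 set0) //= big1 ?addr0 // => S.
by rewrite subset0 => /andP[->].
Qed.

Lemma ev_set1 (R : realFieldType) (T : finType) (c : {set T} -> R) (i : T) :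
  ev c [set i] = c set0 + c [set i].
Proof.
rewrite /ev (bigD1 set0) ?sub0set //= (bigD1 [set i]) ?subxx //=; last first.
  by apply/set0Pn; exists i; rewrite set11.
rewrite big1 ?addr0 // => S; rewrite subset1 -andbA => /andP[] /orP[]/eqP->.
  by rewrite eqxx andbF.
by rewrite eqxx.
Qed.

Lemma ev_off (R : realFieldType) (T : finType) (c : {set T} -> R) (j : T) (X Y : {set T}) :
  (forall S : {set T}, j \in S -> c S = 0) -> X :\ j = Y :\ j -> ev c X = ev c Y.
Proof.
move=> cj XY; rewrite /ev (bigID (fun S : {set T} => j \in S)) /=.
rewrite big1 ?add0r => [|S /andP[_ /cj]//].
rewrite [RHS](bigID (fun S : {set T} => j \in S)) /=.
rewrite [X in _ = X + _]big1 ?add0r => [|S /andP[_ /cj]//].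
by apply: eq_bigl => S; rewrite -!subsetD1 XY.
Qed.

(** Substitution of the constant [b] for the variable [j]. The index type stays [T], and [j] becomes
    irrelevant, so that restrictions can be iterated without changing types. *)
Definition res (R : realFieldType) (T : finType) (j : T) (b : bool) (c : {set T} -> R)
    (S : {set T}) : R :=
  if j \in S then 0 else c S + (if b then c (j |: S) else 0).

Lemma ev_res (R : realFieldType) (T : finType) (j : T) (b : bool) (c : {set T} -> R) X :
  ev (res j b c) X = ev c (if b then j |: X else X :\ j).
Proof.
rewrite /ev /res.
under eq_bigr do rewrite -if_neg.
rewrite -big_mkcondr /= big_split /=.
have -> : \sum_(S : {set T} | (S \subset X) && (j \notin S)) c S = ev c (X :\ j).
  by apply: eq_bigl => S; rewrite subsetD1.
case: b; last by rewrite big1 ?addr0.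
rewrite [RHS](bigID (fun S : {set T} => j \in S)) /= addrC; congr (_ + _).
  rewrite [RHS](reindex_onto (fun S : {set T} => j |: S) (fun S : {set T} => S :\ j)) /=;
    last first.
    by move=> S /andP[_ jS]; rewrite setD1K.
  apply: eq_bigl => S; rewrite setU11 andbT.
  have [jS|jS] /= := boolP (j \in S).
    rewrite andbF; apply/esym/negbTE; rewrite negb_and; apply/orP; right.
    by apply/eqP => /setP /(_ j); rewrite !inE eqxx jS.
  rewrite setU1K // eqxx !andbT.
  apply/idP/idP => [|/subsetP sS]; first exact: setUS.
  apply/subsetP => x xS; have := sS x; rewrite !inE xS orbT => /(_ isT).
  by case: eqP => // xj; rewrite -xj xS in jS.
apply: eq_bigl => S; rewrite -!subsetD1.
suff -> : (j |: X) :\ j = X :\ j by [].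
by apply/setP => x; rewrite !inE; case: eqP.
Qed.

(** * Weights of variables and influences *)

Definition mean (R : realFieldType) (T : finType) (g : {set T} -> R) : R :=
  (\sum_(X : {set T}) g X) / (#|{set T}|)%:R.

Lemma card_set_gt0 (R : realFieldType) (T : finType) : 0 < (#|{set T}|)%:R :> R.
Proof. by rewrite ltr0n; apply/card_gt0P; exists set0. Qed.

Lemma eq_mean (R : realFieldType) (T : finType) (g h : {set T} -> R) :
  g =1 h -> mean g = mean h.
Proof. by move=> gh; congr (_ / _); apply: eq_bigr. Qed.

Lemma mean_const (R : realFieldType) (T : finType) (a : R) : mean (fun _ : {set T} => a) = a.
Proof.
rewrite /mean sumr_const -[a *+ _]mulr_natr mulfK //.
by rewrite gt_eqF // card_set_gt0.
Qed.

Lemma meanD (R : realFieldType) (T : finType) (g h : {set T} -> R) :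
  mean (fun X => g X + h X) = mean g + mean h.
Proof. by rewrite /mean big_split mulrDl. Qed.

Lemma meanZ (R : realFieldType) (T : finType) (a : R) (g : {set T} -> R) :
  mean (fun X => a * g X) = a * mean g.
Proof. by rewrite /mean -mulr_sumr mulrA. Qed.

Lemma mean_sum (R : realFieldType) (T I : finType) (P : pred I) (g : I -> {set T} -> R) :
  mean (fun X => \sum_(i | P i) g i X) = \sum_(i | P i) mean (g i).
Proof. by rewrite /mean exchange_big mulr_suml. Qed.

Lemma le_mean (R : realFieldType) (T : finType) (g h : {set T} -> R) :
  (forall X, g X <= h X) -> mean g <= mean h.
Proof.
move=> gh; rewrite /mean ler_pM2r ?invr_gt0 ?card_set_gt0 //.
by apply: ler_sum => X _.
Qed.

(** Toggling [j] is an involution of the cube, so [g] and its toggled version have the same sum. *)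
Lemma mean_flip (R : realFieldType) (T : finType) (j : T) (g : {set T} -> R) :
  mean g = mean (fun X => (g (j |: X) + g (X :\ j)) / 2).
Proof.
rewrite /mean; congr (_ / _).
pose tau (X : {set T}) := if j \in X then X :\ j else j |: X.
have tauK : involutive tau.
  move=> X; rewrite /tau; have [jX|jX] := boolP (j \in X).
    by rewrite setD11 setD1K.
  by rewrite setU11 setU1K.
have sum_tau : \sum_X g X = \sum_X g (tau X).
  by rewrite (reindex_inj (inv_inj tauK)).
rewrite -mulr_suml (_ : \sum_X (_ + _) = \sum_X g X + \sum_X g (tau X)).
  by rewrite -sum_tau; field.
rewrite -big_split; apply: eq_bigr => X _; rewrite /tau.
have [jX|jX] := boolP (j \in X).
  by congr (g _ + g _); apply/setP => x; rewrite !inE; case: eqP => // ->.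
rewrite addrC; congr (g _ + g _); apply/setP => x; rewrite !inE; case: eqP => // ->.
exact/esym/negbTE.
Qed.

Definition relv (R : realFieldType) (T : finType) (c : {set T} -> R) (i : T) : bool :=
  [exists S : {set T}, (i \in S) && (c S != 0)].

Definition vardeg (R : realFieldType) (T : finType) (c : {set T} -> R) (i : T) : nat :=
  \max_(S : {set T} | (i \in S) && (c S != 0)) #|S|.

Definition wt (R : realFieldType) (T : finType) (c : {set T} -> R) (i : T) : R :=
  if relv c i then 2^-1 ^+ vardeg c i else 0.

Lemma half_ge0 (R : realFieldType) : 0 <= 2^-1 :> R.
Proof. by lra. Qed.

Lemma half_le1 (R : realFieldType) : 2^-1 <= 1 :> R.
Proof. by lra. Qed.

Lemma wt_ge0 (R : realFieldType) (T : finType) (c : {set T} -> R) i : 0 <= wt c i.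
Proof. by rewrite /wt; case: ifP => // _; rewrite exprn_ge0 ?half_ge0. Qed.

Lemma wt_le (R : realFieldType) (T : finType) (c : {set T} -> R) i (S : {set T}) :
  i \in S -> c S != 0 -> wt c i <= 2^-1 ^+ #|S|.
Proof.
move=> iS cS; rewrite /wt; case: ifP => [_|_]; last by rewrite exprn_ge0 ?half_ge0.
rewrite ler_wiXn2l ?half_ge0 ?half_le1 //.
exact: (leq_bigmax_cond (F := fun S : {set T} => #|S|)) (introT andP (conj iS cS)).
Qed.

Lemma wt_ge (R : realFieldType) (T : finType) (c : {set T} -> R) i k :
  relv c i -> (forall S : {set T}, i \in S -> c S != 0 -> (#|S| <= k)%N) ->
  2^-1 ^+ k <= wt c i.
Proof.
move=> ci ck; rewrite /wt ci ler_wiXn2l ?half_ge0 ?half_le1 //.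
by apply/bigmax_leqP => S /andP[]; apply: ck.
Qed.

Lemma vardegP (R : realFieldType) (T : finType) (c : {set T} -> R) i : relv c i ->
  exists S : {set T}, [/\ i \in S, c S != 0 & vardeg c i = #|S|].
Proof.
case/existsP => S0 S0P; rewrite /vardeg (bigop.bigmax_eq_arg S0) //.
by case: arg_maxnP => // S /andP[iS cS] _; exists S.
Qed.

Lemma relv_memo (R : realFieldType) (T : finType) (c : {set T} -> R) i (S : {set T}) :
  i \in S -> c S != 0 -> relv c i.
Proof. by move=> iS cS; apply/existsP; exists S; rewrite iS. Qed.

Lemma not_relv (R : realFieldType) (T : finType) (c : {set T} -> R) i (S : {set T}) :
  ~~ relv c i -> i \in S -> c S = 0.
Proof. by move=> ci iS; apply: contraNeq ci => cS; apply: relv_memo cS. Qed.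

(* If [i] is relevant in only one of the two restrictions of [j], then every monomial of
   that restriction containing [i] comes from one of [c] containing both [i] and [j]. *)
Lemma wt_res (R : realFieldType) (T : finType) (c : {set T} -> R) i j : i != j ->
  wt c i <= (wt (res j true c) i + wt (res j false c) i) / 2.
Proof.
move=> ij; have [ci|ci] := boolP (relv c i); last first.
  by rewrite {1}/wt (negbTE ci) divr_ge0 ?addr_ge0 ?wt_ge0.
rewrite ler_pdivlMr //.
have ubd (S : {set T}) : i \in S -> c S != 0 -> (#|S| <= vardeg c i)%N.
  by move=> iS cS; apply: (leq_bigmax_cond (F := fun S : {set T} => #|S|)); rewrite iS.
have wtE : wt c i = 2^-1 ^+ vardeg c i by rewrite /wt ci.
have iU (S : {set T}) : (i \in j |: S) = (i \in S) by rewrite !inE (negbTE ij).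
have res_deg b (S : {set T}) : i \in S -> res j b c S != 0 -> (#|S| <= vardeg c i)%N.
  move=> iS; rewrite /res; case: ifP; first by rewrite eqxx.
  move=> jS; have [->|cS _] := eqVneq (c S) 0; last exact: ubd.
  rewrite add0r; case: b; last by rewrite eqxx.
  move=> cjS; have := ubd (j |: S); rewrite iU cardsU1 jS => /(_ iS cjS).
  by apply: leq_trans; rewrite leq_addl.
(* When [i] survives in one restriction only, the degree of [i] drops by at least one there; the
   doubled weight makes up for the zero weight in the other restriction. *)
have resS_wt b : relv (res j b c) i ->
    (forall S : {set T}, i \in S -> j \notin S -> res j b c S != 0 -> c (j |: S) != 0) ->
    wt c i * 2 <= wt (res j b c) i.
  move=> ri resc; have [S0 [iS0 cS0 _]] := vardegP ri.
  have jS (S : {set T}) : res j b c S != 0 -> j \notin S.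
    by apply: contra => jS; rewrite /res jS.
  have degS (S : {set T}) : i \in S -> res j b c S != 0 -> (#|S| < vardeg c i)%N.
    move=> iS rS; have := ubd (j |: S); rewrite iU cardsU1 (jS _ rS).
    by move=> /(_ iS (resc _ iS (jS _ rS) rS)).
  have D_gt0 : (0 < vardeg c i)%N by apply: leq_trans (degS _ iS0 cS0).
  have -> : wt c i * 2 = 2^-1 ^+ (vardeg c i).-1.
    by rewrite wtE -{1}(prednK D_gt0) exprSr -mulrA mulVf ?mulr1 ?pnatr_eq0.
  by apply: wt_ge => // S iS rS; rewrite -ltnS prednK //; apply: degS.
have [r1|r1] := boolP (relv (res j true c) i); last first.
  have c0 (S : {set T}) : i \in S -> j \notin S -> c (j |: S) = - c S.
    move=> iS jS; have := not_relv r1 iS; rewrite /res (negbTE jS).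
    by move/eqP; rewrite addrC addr_eq0 => /eqP.
  have [r0|r0] := boolP (relv (res j false c) i).
    rewrite (le_trans (resS_wt false r0 _)) ?lerDr ?wt_ge0 //.
    by move=> S iS jS; rewrite /res (negbTE jS) addr0 c0 // oppr_eq0.
  (* If [i] survived in neither restriction, all coefficients of sets containing [i] would vanish,
     with or without [j]. *)
  have [S [iS cS _]] := vardegP ci.
  have [jS|jS] := boolP (j \in S); last first.
    by have := not_relv r0 iS; rewrite /res (negbTE jS) addr0 => /eqP; rewrite (negbTE cS).
  have iS' : i \in S :\ j by rewrite !inE ij.
  have jS' : j \notin S :\ j by rewrite !inE eqxx.
  have := not_relv r0 iS'; rewrite /res (negbTE jS') addr0 => c1.
  by have := c0 _ iS' jS'; rewrite setD1K // c1 oppr0 => /eqP; rewrite (negbTE cS).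
have [r0|r0] := boolP (relv (res j false c) i).
  rewrite mulr_natr mulr2n lerD // wtE; first exact: wt_ge r1 (@res_deg true).
  exact: wt_ge r0 (@res_deg false).
rewrite (le_trans (resS_wt true r1 _)) ?lerDl ?wt_ge0 //.
move=> S iS jS; have := not_relv r0 iS; rewrite /res (negbTE jS) addr0 => ->.
by rewrite add0r.
Qed.

Definition resseq (R : realFieldType) (T : finType) (s : seq T) (X : {set T})
    (c : {set T} -> R) : {set T} -> R :=
  foldr (fun j => res j (j \in X)) c s.

Lemma resseq_eqX (R : realFieldType) (T : finType) (s : seq T) (X Y : {set T})
    (c : {set T} -> R) : {in s, X =i Y} -> resseq s X c = resseq s Y c.
Proof.
elim: s => //= j s IH XY; rewrite XY ?mem_head // IH // => x xs.
by rewrite XY // in_cons xs orbT.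
Qed.

Lemma wt_resseq (R : realFieldType) (T : finType) (c : {set T} -> R) i (s : seq T) :
  uniq s -> i \notin s -> wt c i <= mean (fun X => wt (resseq s X c) i).
Proof.
elim: s => [_ _|j s IH] /=; first by rewrite mean_const.
rewrite in_cons negb_or => /andP[js us] /andP[ij is'].
apply: (le_trans (IH us is')); rewrite [X in _ <= X](mean_flip j).
apply: le_mean => X; rewrite setU11 setD11.
have -> : resseq s (j |: X) c = resseq s X c.
  by apply: resseq_eqX => x xs; rewrite !inE; case: eqP => // xj; rewrite -xj xs in js.
have -> : resseq s (X :\ j) c = resseq s X c.
  by apply: resseq_eqX => x xs; rewrite !inE; case: eqP => // xj; rewrite -xj xs in js.
exact: wt_res.
Qed.

(** Each restriction merges [S] with [j |: S], so a surviving monomial is the trace outside [s] of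
    an original one. This controls the degree after restriction. *)
Lemma resseq_neq0 (R : realFieldType) (T : finType) (s : seq T) (X : {set T})
    (c : {set T} -> R) (S : {set T}) : resseq s X c S != 0 ->
  {in s, forall x, x \notin S} /\
  exists B : {set T}, {subset B <= s} /\ c (S :|: B) != 0.
Proof.
elim: s S => [|j s IH] S /=.
  by move=> cS; split=> //; exists set0; rewrite setU0; split=> // x; rewrite inE.
rewrite /res; case: ifP => [_|/negbT jS]; first by rewrite eqxx.
have [r0|r0 _] := eqVneq (resseq s X c S) 0.
  rewrite r0 add0r; case: ifP => [_|_]; last by rewrite eqxx.
  move=> /IH[sj [B [sB cB]]]; split.
    move=> x; rewrite in_cons => /orP[/eqP->//|/sj].
    by apply: contra => xS; rewrite !inE xS orbT.
  exists (j |: B); rewrite setUCA setUA; split=> // x.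
  by rewrite !inE => /orP[->//|/sB->]; rewrite orbT.
have [sS [B [sB cB]]] := IH _ r0; split.
  by move=> x; rewrite in_cons => /orP[/eqP->//|/sS].
by exists B; split=> // x /sB; rewrite in_cons orbC => ->.
Qed.

Lemma ev_resseq (R : realFieldType) (T : finType) (s : seq T) (X Y : {set T})
    (c : {set T} -> R) :
  ev (resseq s X c) Y = ev c [set x | if x \in s then x \in X else x \in Y].
Proof.
elim: s Y => [|j s IH] Y /=; first by congr ev; apply/setP => x; rewrite inE.
rewrite ev_res IH; congr ev; apply/setP => x; rewrite !inE.
have [->|xj] /= := eqVneq x j.
  by case: ifP => // _; case: (j \in X); rewrite !inE eqxx.
by case: ifP => // _; case: (j \in X); rewrite !inE (negbTE xj).
Qed.

Lemma resseq_bool (R : realFieldType) (T : finType) (s : seq T) (X : {set T})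
    (c : {set T} -> R) : bool_valued (ev c) -> bool_valued (ev (resseq s X c)).
Proof. by move=> bc Y; rewrite ev_resseq. Qed.

(** For a Boolean-valued function, the probability that toggling [i] changes the value. *)
Definition influence (R : realFieldType) (T : finType) (c : {set T} -> R) (i : T) : R :=
  mean (fun X => (ev c (i |: X) - ev c (X :\ i)) ^+ 2).

(** Once all variables but [i] are fixed, a Boolean function is constant, of weight 0, or of degree
    one in [i], of weight 1/2; the second case is exactly a sensitive edge. *)
Lemma wt_influence (R : realFieldType) (T : finType) (c : {set T} -> R) i :
  bool_valued (ev c) -> wt c i <= influence c i / 2.
Proof.
move=> bc; pose s := enum (~: [set i]).
have sE x : (x \in s) = (x != i) by rewrite mem_enum !inE.
have is' : i \notin s by rewrite sE eqxx.
apply: (le_trans (wt_resseq c (enum_uniq _) is')).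
rewrite /influence mulrC -meanZ; apply: le_mean => X.
set c' := resseq _ _ _.
have c'i : c' [set i] = ev c (i |: X) - ev c (X :\ i).
  have evi := ev_set1 c' i; have ev0 := ev_set0 c'.
  rewrite -[LHS](addKr (c' set0)) -evi -ev0 !ev_resseq addrC.
  by congr (ev c _ - ev c _); apply/setP => x; rewrite !inE -/s sE;
     case: (eqVneq x i) => [->|].
have c'S (S : {set T}) : c' S != 0 -> S \subset [set i].
  move=> /resseq_neq0[sS _]; apply/subsetP => x xS; rewrite inE.
  by apply: contraLR xS => xi; apply: sS; rewrite -/s sE.
rewrite -c'i; have [c0|c0] := eqVneq (c' [set i]) 0.
  rewrite c0 expr0n /= mulr0 /wt; case: ifP => // /existsP[S /andP[iS cS]].
  have := c'S _ cS; rewrite subset1 => /orP[]/eqP SE; first by rewrite SE c0 eqxx in cS.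
  by rewrite SE inE in iS.
have := wt_le (set11 i) c0; rewrite cards1 expr1 => /le_trans; apply.
rewrite c'i; rewrite c'i in c0; move: c0.
by case: (bc (i |: X)) => ->; case: (bc (X :\ i)) => ->; rewrite ?subrr ?eqxx // => _; lra.
Qed.

(** The classical bound of total influence by degree, for any real polynomial. Instead of a Fourier
    expansion, variables are split off one at a time, by induction on a set [A] containing all
    monomials. *)
Lemma total_influence_le (R : realFieldType) (T : finType) (c : {set T} -> R) d :
  coef_deg_le c d -> \sum_i influence c i <= 4 * d%:R * mean (fun X => ev c X ^+ 2).
Proof.
have [A] : exists A : {set T}, forall S, c S != 0 -> S \subset A.
  by exists setT => S _; apply: subsetT.
elim/ltn_ind: #|A| {-2}A (erefl #|A|) c d => m IH {}A cardA c d cA cd.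
have [A0|[j jA]] := set_0Vmem A.
  have evE X : ev c X = c set0.
    rewrite /ev (bigD1 set0) ?sub0set //= big1 ?addr0 // => S /andP[_ S0].
    by apply: contraNeq S0 => /cA; rewrite A0 subset0.
  rewrite big1 => [|i _]; last first.
    by rewrite -(mean_const T (0 : R)); apply: eq_mean => X; rewrite !evE subrr expr0n.
  apply: mulr_ge0; first by rewrite mulr_ge0 ?ler0n.
  rewrite -[X in X <= _](@mean_const R T 0).
  by apply: le_mean => X; apply: sqr_ge0.
(* The decomposition [a + s b] with [s] the sign [1] or [-1] of the bit [j]: squared norms add up,
   [j] has influence [4 E b ^ 2], and [b] has degree one less. *)
pose b (S : {set T}) := if j \in S then 0 else c (j |: S) / 2.
pose a (S : {set T}) := if j \in S then 0 else c S + c (j |: S) / 2.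
have aj (S : {set T}) : j \in S -> a S = 0 by rewrite /a => ->.
have bj (S : {set T}) : j \in S -> b S = 0 by rewrite /b => ->.
have evU X : ev c (j |: X) = ev a X + ev b X.
  rewrite -(ev_res j true) /ev -big_split; apply: eq_bigr => S _.
  by rewrite /res /a /b; case: ifP => _ /=; field.
have evD X : ev c (X :\ j) = ev a X - ev b X.
  rewrite -(ev_res j false) /ev -sumrB; apply: eq_bigr => S _.
  by rewrite /res /a /b; case: ifP => _ /=; field.
have jU (X : {set T}) : (j |: X) :\ j = X :\ j.
  by apply/setP => x; rewrite !inE; case: eqP.
have jD (X : {set T}) : (X :\ j) :\ j = X :\ j.
  by apply/setP => x; rewrite !inE; case: eqP.
have iU i (X : {set T}) : i |: (j |: X) = j |: (i |: X) by rewrite setUCA.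
have iUD i (X : {set T}) : i != j -> i |: (X :\ j) = (i |: X) :\ j.
  move=> ij; apply/setP => x; rewrite !inE; case: (eqVneq x i) => [->|//].
  by rewrite ij.
have iDU i (X : {set T}) : i != j -> (j |: X) :\ i = j |: (X :\ i).
  move=> ij; apply/setP => x; rewrite !inE; case: (eqVneq x i) => [->|//].
  by rewrite (negbTE ij).
have iDD i (X : {set T}) : (X :\ j) :\ i = (X :\ i) :\ j.
  by rewrite !setDDl setUC.
have infj (c' : {set T} -> R) : (forall S : {set T}, j \in S -> c' S = 0) -> influence c' j = 0.
  move=> c'j; rewrite -(mean_const T (0 : R)); apply: eq_mean => X.
  by rewrite (ev_off c'j (jU X)) (ev_off c'j (jD X)) subrr expr0n.
have infi i : i != j -> influence c i = influence a i + influence b i.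
  move=> ij; rewrite /influence (mean_flip j) -meanD; apply: eq_mean => X.
  by rewrite iU // iDU // iUD // iDD !evU !evD; field.
have infcj : influence c j = 4 * mean (fun X => ev b X ^+ 2).
  by rewrite -meanZ; apply: eq_mean => X; rewrite evU evD; ring.
have normc : mean (fun X => ev c X ^+ 2) =
    mean (fun X => ev a X ^+ 2) + mean (fun X => ev b X ^+ 2).
  rewrite (mean_flip j) -meanD; apply: eq_mean => X.
  by rewrite evU evD; field.
have sumE : \sum_i influence c i =
    4 * mean (fun X => ev b X ^+ 2) + \sum_i influence a i + \sum_i influence b i.
  have split_j (c' : {set T} -> R) :
    \sum_i influence c' i = influence c' j + \sum_(i | i != j) influence c' i.
    by rewrite (bigD1 j).
  rewrite !split_j infcj (infj a aj) (infj b bj) !add0r -addrA; congr (_ + _).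
  by rewrite -big_split; apply: eq_bigr => i ij; apply: infi.
have cardD : (#|A :\ j| < m)%N by rewrite -cardA [X in (_ < X)%N](cardsD1 j) jA.
have aA S : a S != 0 -> S \subset A :\ j.
  rewrite /a; case: ifP => [_|jS]; first by rewrite eqxx.
  have [->|cS _] := eqVneq (c S) 0; last by rewrite subsetD1 cA ?jS.
  rewrite add0r mulf_eq0 => /norP[/cA + _].
  by rewrite subUset subsetD1 jS => /andP[_ ->].
have bA S : b S != 0 -> S \subset A :\ j.
  rewrite /b; case: ifP => [_|jS]; first by rewrite eqxx.
  rewrite mulf_eq0 => /norP[/cA + _].
  by rewrite subUset subsetD1 jS => /andP[_ ->].
have ad : coef_deg_le a d.
  move=> S; rewrite /a; case: ifP => [_|jS]; first by rewrite eqxx.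
  have [->|cS _] := eqVneq (c S) 0; last exact: cd.
  rewrite add0r mulf_eq0 => /norP[/cd + _].
  by rewrite cardsU1 jS; apply: leq_trans; rewrite leq_addl.
have bd (S : {set T}) : b S != 0 -> (#|S| < d)%N.
  rewrite /b; case: ifP => [_|jS]; first by rewrite eqxx.
  by rewrite mulf_eq0 => /norP[/cd + _]; rewrite cardsU1 jS.
have IHa := IH _ cardD _ (erefl _) a d aA ad.
rewrite sumE normc mulrDr.
case: d cd ad bd IHa => [|d] cd ad bd IHa.
  have evb X : ev b X = 0.
    by apply: big1 => S _; apply: contraTeq isT => /bd.
  have -> : mean (fun X => ev b X ^+ 2) = 0.
    by rewrite -(mean_const T (0 : R)); apply: eq_mean => X; rewrite evb expr0n.
  have -> : \sum_i influence b i = 0.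
    apply: big1 => i _; rewrite -(mean_const T (0 : R)); apply: eq_mean => X.
    by rewrite !evb subrr expr0n.
  by move: IHa; lra.
have IHb := IH _ cardD _ (erefl _) b d bA bd.
by rewrite [in X in _ <= _ + X]mulrSr; lra.
Qed.

Lemma sum_wt_le_half_deg (R : realFieldType) (T : finType) (c : {set T} -> R) d :
  bool_valued (ev c) -> coef_deg_le c d -> \sum_i wt c i <= d%:R / 2.
Proof.
move=> bc cd.
(* Subtracting 1/2 keeps all influences and makes the square constantly 1/4, which cancels the
   factor 4. *)
pose c' (S : {set T}) := c S - (if S == set0 then 2^-1 else 0).
have evc' X : ev c' X = ev c X - 2^-1.
  rewrite /ev sumrB; congr (_ - _).
  rewrite (bigD1 set0) ?sub0set //= eqxx big1 ?addr0 // => S /andP[_ S0].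
  by rewrite (negbTE S0).
have c'd : coef_deg_le c' d.
  move=> S; have [->|S0] := eqVneq S set0; first by rewrite cards0.
  rewrite /c' (negbTE S0).
  by rewrite subr0; apply: cd.
have inf' i : influence c' i = influence c i.
  by apply: eq_mean => X; rewrite !evc'; congr (_ ^+ 2); ring.
have := total_influence_le c'd.
rewrite (@eq_mean _ _ _ (fun => 4^-1)) => [|X]; last first.
  by rewrite evc'; case: (bc X) => ->; field.
rewrite mean_const => inf_le.
have : \sum_i wt c i <= \sum_i influence c' i / 2.
  by apply: ler_sum => i _; rewrite inf'; apply: wt_influence.
by rewrite -mulr_suml; lra.
Qed.

(** * Markov's inequality at an endpoint *)

(** Lagrange interpolation at the nodes [y]: as 0 lies to the left of all of them, the [j]-th basis
    polynomial has sign [(-1) ^+ j] at 0, so every term is nonpositive. *)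
Lemma interpolation_at0_le0 (F : realFieldType) (n : nat) (y : nat -> F) (E : {poly F}) :
  (size E <= n)%N ->
  (forall i, (i < n)%N -> 0 < y i) ->
  (forall i j, (i < j)%N -> (j < n)%N -> y i < y j) ->
  (forall i, (i < n)%N -> (-1) ^+ i * E.[y i] <= 0) ->
  E.[0] <= 0.
Proof.
move=> sE y_gt0 y_incr Ey.
have y_neq i j : (i < n)%N -> (j < n)%N -> i != j -> y i != y j.
  move=> ni nj; rewrite neq_ltn => /orP[ij|ji]; first by rewrite lt_eqF ?y_incr.
  by rewrite gt_eqF ?y_incr.
pose L (j : 'I_n) : {poly F} := \prod_(k < n | k != j) ('X - (y k)%:P).
have Lx j x : (L j).[x] = \prod_(k < n | k != j) (x - y k).
  by rewrite horner_prod; apply: eq_bigr => k _; rewrite !hornerE.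
have Lneq0 j : (L j).[y j] != 0.
  rewrite Lx; apply/prodf_neq0 => k kj.
  by rewrite subr_eq0 y_neq // eq_sym.
have L0 (i j : 'I_n) : i != j -> (L j).[y i] = 0.
  by move=> ij; rewrite Lx (bigD1 i) //= subrr mul0r.
have sL j : (size (L j) <= n)%N.
  have := size_prod_leq (fun k : 'I_n => k != j) (fun k => 'X - (y k)%:P).
  rewrite -/(L j) (eq_bigr (fun=> 2)) => [|k _]; last by rewrite size_XsubC.
  have cP : #|fun k : 'I_n => k != j| = n.-1 by rewrite -[n in RHS]card_ord -(cardC1 j).
  rewrite sum_nat_const !cP => /leq_trans; apply.
  by have := ltn_ord j; lia.
pose q := \sum_(j < n) (E.[y j] / (L j).[y j]) *: L j.
have qy (i : 'I_n) : q.[y i] = E.[y i].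
  rewrite /q horner_sum (bigD1 i) //= big1 => [|j ji].
    by rewrite hornerZ mulfVK ?addr0.
  by rewrite hornerZ (L0 i j) ?mulr0 // eq_sym.
have Eq : E = q.
  apply/eqP; rewrite -subr_eq0; apply/eqP.
  apply: (@roots_geq_poly_eq0 _ _ (mkseq y n)).
  - apply/allP => x /mapP[i]; rewrite mem_iota add0n => /andP[_ ni] ->.
    by rewrite /root !hornerE (qy (Ordinal ni)) subrr.
  - rewrite map_inj_in_uniq ?iota_uniq // => i j; rewrite !mem_iota !add0n => ni nj yij.
    by apply: contra_eq yij => ij; apply: y_neq.
  rewrite size_mkseq (leq_trans (size_polyD _ _)) // geq_max sE size_polyN.
  apply: (leq_trans (size_sum _ _ _)); apply/bigmax_leqP => j _.
  exact: leq_trans (size_scale_leq _ _) (sL j).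
rewrite Eq horner_sum; apply: sumr_le0 => j _.
rewrite hornerZ.
have signE : (-1) ^+ j = \prod_(k < n | k != j) (if (k < j)%N then -1 else 1) :> F.
  rewrite [RHS](bigID (fun k : 'I_n => (k < j)%N)) /=.
  rewrite [X in _ = _ * X]big1 => [|k /andP[_ /negbTE->]//].
  rewrite mulr1 (eq_big (fun k : 'I_n => (k < j)%N) (fun=> -1)) => [|k|k /andP[_ ->]//].
    by rewrite (big_ord_narrow (ltnW (ltn_ord j))) prodr_const card_ord.
  by rewrite -val_eqE /=; case: ltngtP.
have ratio_ge0 : 0 <= (-1) ^+ j * ((L j).[0] / (L j).[y j]).
  rewrite signE !Lx -prodf_div -big_split; apply: prodr_ge0 => k kj /=.
  rewrite sub0r; case: ifP => [kj'|/negbT kj'].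
    rewrite mulN1r mulNr opprK divr_ge0 ?ltW ?y_gt0 // subr_gt0 y_incr //.
  have jk : (j < k)%N by rewrite ltn_neqAle eq_sym kj leqNgt.
  rewrite mul1r -[X in _ / X]opprB mulNr invrN mulrN opprK.
  by rewrite divr_ge0 ?ltW ?y_gt0 // subr_gt0 y_incr.
have sgn2 : (-1) ^+ j * (-1) ^+ j = 1 :> F by rewrite -exprD addnn -mul2n exprM sqrrN !expr1n.
have -> : E.[y j] / (L j).[y j] * (L j).[0] =
    ((-1) ^+ j * E.[y j]) * ((-1) ^+ j * ((L j).[0] / (L j).[y j])).
  rewrite mulrACA sgn2 mul1r; ring.
exact: mulr_le0_ge0 (Ey _ (ltn_ord j)) ratio_ge0.
Qed.

(* The polynomials [T_n (1 - 2 X)], with [T_n] the Chebyshev polynomials. *)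
Lemma shifted_chebyshev (R : realType) (n : nat) : exists C : {poly R},
  [/\ (size C <= n.+1)%N, forall t, C.[(1 - cos t) / 2] = cos (n%:R * t)
    & C^`().[0] = - 2 * n%:R ^+ 2].
Proof.
pose P n (C : {poly R}) := [/\ (size C <= n.+1)%N,
  forall t, C.[(1 - cos t) / 2] = cos (n%:R * t) & C^`().[0] = - 2 * n%:R ^+ 2].
suff [C [_ [? _]]] : exists C C', P n C /\ P n.+1 C' by exists C.
pose u : {poly R} := 1 - 2%:P * 'X.
have ux x : u.[x] = 1 - 2 * x by rewrite !hornerE.
have du : u^`() = (- 2)%:P by rewrite /u !poly.derivE mulr1 sub0r polyCN.
have su : (size u <= 2)%N.
  rewrite (leq_trans (size_polyD _ _)) // geq_max size_poly1 size_polyN /=.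
  by rewrite (leq_trans (size_polyMleq _ _)) // size_polyX addn2 /= size_polyC; case: eqP.
clearbody u; elim: n => [|n [C [C' [PC PC']]]].
  exists 1, u; split; split.
  - by rewrite size_poly1.
  - by move=> t; rewrite hornerE mul0r cos0.
  - by rewrite derivC horner0 expr0n mulr0.
  - exact: su.
  - by move=> t; rewrite ux mul1r; field.
  - by rewrite du hornerE expr1n mulr1.
(* The Chebyshev recurrence in the variable [u = 1 - 2 X]. *)
exists C', (2%:P * u * C' - C); split=> //.
have [sC Ccos dC] := PC; have [sC' C'cos dC'] := PC'.
have C'0 : C'.[0] = 1 by have := C'cos 0; rewrite cos0 mulr0 cos0 subrr mul0r.
split.
- rewrite (leq_trans (size_polyD _ _)) // geq_max size_polyN.
  rewrite (leq_trans sC) ?andbT; last by lia.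
  rewrite mul_polyC -scalerAl (leq_trans (size_scale_leq _ _)) //.
  by rewrite (leq_trans (size_polyMleq _ _)) //; lia.
- move=> t; rewrite !hornerE ux Ccos C'cos.
  have -> : n.+2%:R * t = n.+1%:R * t + t by rewrite [n.+2%:R]mulrSr mulrDl mul1r.
  have -> : n%:R * t = n.+1%:R * t - t by rewrite [n.+1%:R]mulrSr mulrDl mul1r addrK.
  by rewrite cosB cosD; field.
rewrite [LHS](_ : _ = 2 * -2 + 2 * C'^`().[0] - C^`().[0]); last first.
  by rewrite !poly.derivE du !hornerE C'0 ux mulr0 subr0 !mulr1.
rewrite dC dC' [n.+2%:R]mulrSr [n.+1%:R]mulrSr; ring.
Qed.

(** The extremal polynomial is [(1 - C) / 2], with [C] the shifted Chebyshev polynomial: it vanishes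
    at 0 with slope [d ^ 2]. The difference [D] from it is [X q], and the claim becomes [q.[0] <=
    0]. *)
Lemma markov_at0 (R : realType) (P : {poly R}) (d : nat) :
  (size P <= d.+1)%N -> (forall x, 0 <= x <= 1 -> 0 <= P.[x] <= 1) -> P.[0] = 0 ->
  P^`().[0] <= d%:R ^+ 2.
Proof.
move=> sP P01 P0; case: d sP => [|d] sP.
  have -> : P = (P`_0)%:P by apply: size1_polyC.
  by rewrite derivC horner0 sqr_ge0.
have [C [sC Ccos dC]] := shifted_chebyshev R d.+1.
have C0 : C.[0] = 1 by have := Ccos 0; rewrite cos0 mulr0 cos0 subrr mul0r.
pose D := P - 2^-1%:P * (1 - C).
have /factor_theorem[q Dq] : root D 0 by rewrite /root !hornerE P0 C0 subrr mulr0 subr0.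
have -> : P^`().[0] = d.+1%:R ^+ 2 + q.[0].
  have : D^`().[0] = q.[0].
    by rewrite Dq derivM derivXsubC hornerD !hornerM hornerXsubC subrr mulr0 add0r hornerC mulr1.
  rewrite /D !poly.derivE !hornerE dC => <-; by field.
rewrite gerDl.
(* The angles where [(1 - C) / 2] is alternately 1 and 0, which forces the sign of [D] to alternate.
   The numerator [j.+1] skips the angle 0, whose node is the root divided out of [D]. *)
pose t (j : nat) : R := j.+1%:R / d.+1%:R * pi.
have t_in j : (j < d.+1)%N -> 0 < t j <= pi.
  move=> jd; rewrite !mulr_gt0 ?invr_gt0 ?ltr0n ?pi_gt0 //=.
  by rewrite ler_piMl ?pi_ge0 // ler_pdivrMr ?ltr0n // mul1r ler_nat.
pose y j : R := (1 - cos (t j)) / 2.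
have y01 j : 0 <= y j <= 1.
  by rewrite /y; have := cos_le1 (t j); have := cos_geN1 (t j); lra.
have y_gt0 j : (j < d.+1)%N -> 0 < y j.
  move=> /t_in /andP[t0 tpi]; rewrite divr_gt0 // subr_gt0 -[X in _ < X]cos0.
  by rewrite ltr_cos // in_itv /= ?lexx ?pi_ge0 ?(ltW t0).
apply: (@interpolation_at0_le0 _ d.+1 y).
- have [->|q0] := eqVneq q 0; first by rewrite size_poly0.
  have <- : (size D).-1 = size q.
    by rewrite Dq size_Mmonic ?monicXsubC // size_XsubC addn2.
  rewrite -subn1 leq_subLR add1n (leq_trans (size_polyD _ _)) // geq_max sP.
  rewrite size_polyN mul_polyC (leq_trans (size_scale_leq _ _)) //.
  by rewrite (leq_trans (size_polyD _ _)) // geq_max size_poly1 size_polyN.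
- exact: y_gt0.
- move=> i j ij jd; rewrite /y ltr_pM2r ?invr_gt0 // ltrD2l ltrN2.
  have /andP[ti0 tip] := t_in _ (ltn_trans ij jd); have /andP[tj0 tjp] := t_in _ jd.
  rewrite ltr_cos ?in_itv /= ?(ltW ti0) ?(ltW tj0) //.
  by rewrite /t -mulrA -[X in _ < X]mulrA ltr_pM2r ?ltr_nat // mulr_gt0 ?pi_gt0 // invr_gt0 ltr0n.
move=> j jd.
have cosj : cos (d.+1%:R * t j) = - (-1) ^+ j.
  have -> : d.+1%:R * t j = pi *+ j.+1.
    by rewrite /t -mulr_natl; field; rewrite addrC natr1 pnatr_eq0.
  elim: j {jd} => [|j IH]; first by rewrite mulr1n cospi expr0.
  by rewrite mulrSr cosDpi IH exprS mulN1r.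
have Dy : D.[y j] = P.[y j] - (1 + (-1) ^+ j) / 2.
  by rewrite !hornerE /y Ccos cosj; field.
have qy : q.[y j] = D.[y j] / y j.
  by rewrite Dq !hornerE subr0 mulfK // gt_eqF ?y_gt0.
rewrite qy mulrA pmulr_lle0 ?invr_gt0 ?y_gt0 // Dy.
have /andP[] := P01 _ (y01 j).
by rewrite -signr_odd; case: (odd j); rewrite ?expr0 ?expr1; lra.
Qed.

(** * Disjoint monomials *)

(** Substitution of the variable [phi i] for each variable [i]; monomials with the same image merge
    because bits are idempotent. *)
Definition pushfwd (R : realFieldType) (T U : finType) (phi : T -> U) (c : {set T} -> R)
    (J : {set U}) : R :=
  \sum_(S : {set T} | phi @: S == J) c S.

Lemma ev_pushfwd (R : realFieldType) (T U : finType) (phi : T -> U) (c : {set T} -> R) X :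
  ev (pushfwd phi c) X = ev c (phi @^-1: X).
Proof.
rewrite /ev /pushfwd (exchange_big_dep (fun S : {set T} => phi @: S \subset X)) /=.
  apply: eq_big => [S|S sX]; first by rewrite sub_imset_pre.
  rewrite (bigD1 (phi @: S)) ?sX ?eqxx //= big1 ?addr0 // => J.
  by case/andP => /andP[_ /eqP->]; rewrite eqxx.
by move=> J S JX /eqP->.
Qed.

Lemma pushfwd_deg (R : realFieldType) (T U : finType) (phi : T -> U) (c : {set T} -> R) d :
  coef_deg_le c d -> coef_deg_le (pushfwd phi c) d.
Proof.
move=> cd J; apply: contraR; rewrite -ltnNge => dJ.
rewrite /pushfwd big1 // => S /eqP SJ; apply: contraTeq dJ => /cd Sd.
by rewrite -leqNgt -SJ (leq_trans (leq_imset_card _ _)).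
Qed.

Lemma sum_cards1 (R : realFieldType) (T : finType) (c : {set T} -> R) :
  \sum_(S : {set T} | #|S| == 1%N) c S = \sum_i c [set i].
Proof.
transitivity (\sum_(S in [set [set i] | i in [set: T]]) c S); last first.
  by rewrite big_imset => [|i j _ _ /set1_inj//]; apply: eq_bigl => i; rewrite inE.
apply: eq_bigl => S; apply/esym.
by apply/imsetP/cards1P => [[i _ ->]|[i ->]]; exists i.
Qed.

(* [q ^+ #|S|] is the probability that a random set containing each element independently
   with probability [q] includes [S]. *)
Lemma sum_bernoulli_ev (R : realFieldType) (T : finType) (c : {set T} -> R) (q : R) :
  \sum_(X : {set T}) (\prod_i (if i \in X then q else 1 - q)) * ev c X =
  \sum_(S : {set T}) c S * q ^+ #|S|.
Proof.
under eq_bigr do rewrite /ev mulr_sumr.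
rewrite (exchange_big_dep predT) //=; apply: eq_bigr => S _.
rewrite -mulr_suml mulrC; congr (_ * _).
have -> : q ^+ #|S| = \prod_i (q + (if i \in S then 0 else 1 - q)).
  rewrite -prodr_const big_mkcond; apply: eq_bigr => i _.
  by case: ifP => _; rewrite ?addr0 // addrC subrK.
rewrite bigA_distr big_mkcond; apply: eq_bigr => X _ /=.
case: ifP => [/subsetP SX|/negbT/subsetPn[i iS iX]].
  by apply: eq_bigr => i _; case: ifP => // iX; case: ifP => // /SX; rewrite iX.
by rewrite (bigD1 i) //= (negbTE iX) iS mul0r.
Qed.

(** If the value at the empty set is 0, each [c [set i]] is 0 or 1, so the number of sensitive
    variables is [\sum_i c [set i]], the slope at 0 of the expectation [P]. Negating the function
    reduces to that case. *)
Lemma card_sensitive_at0 (R : realType) (T : finType) (c : {set T} -> R) d :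
  bool_valued (ev c) -> coef_deg_le c d -> (#|[set i | c [set i] != 0%R]| <= d ^ 2)%N.
Proof.
wlog c0 : c / c set0 = 0 => [IH bc cd|].
  have [c0|c0] := bc set0; rewrite ev_set0 in c0; first exact: IH.
  pose c' (S : {set T}) := (if S == set0 then 1 else 0) - c S.
  have evc' X : ev c' X = 1 - ev c X.
    rewrite /ev sumrB; congr (_ - _).
    rewrite (bigD1 set0) ?sub0set //= eqxx big1 ?addr0 // => S /andP[_ S0].
    by rewrite (negbTE S0).
  have -> : [set i | c [set i] != 0] = [set i | c' [set i] != 0].
    apply/setP => i; rewrite !inE /c' -[_ == set0]negbK.
    by rewrite (_ : [set i] != set0) ?sub0r ?oppr_eq0 //; apply/set0Pn; exists i; rewrite set11.
  apply: IH.
  - by rewrite /c' eqxx c0 subrr.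
  - by move=> X; rewrite evc'; case: (bc X) => ->; [right|left]; rewrite ?subr0 ?subrr.
  move=> S; rewrite /c'; have [->|S0] := eqVneq S set0; first by rewrite cards0.
  by rewrite sub0r oppr_eq0; apply: cd.
move=> bc cd.
have ci i : c [set i] = (c [set i] != 0)%:R.
  have := bc [set i]; rewrite ev_set1 c0 add0r.
  by case=> ->; rewrite ?eqxx ?oner_eq0.
pose P : {poly R} := \sum_(S : {set T}) c S *: 'X^#|S|.
have Px x : P.[x] = \sum_(S : {set T}) c S * x ^+ #|S|.
  by rewrite horner_sum; apply: eq_bigr => S _; rewrite hornerZ hornerXn.
have sP : (size P <= d.+1)%N.
  apply: (leq_trans (size_sum _ _ _)); apply/bigmax_leqP => S _.
  have [->|cS] := eqVneq (c S) 0; first by rewrite scale0r size_poly0.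
  by rewrite (leq_trans (size_scale_leq _ _)) // size_polyXn ltnS cd.
have P0 : P.[0] = 0.
  rewrite Px big1 // => S _; have [->|S0] := eqVneq S set0; first by rewrite c0 mul0r.
  by rewrite expr0n cards_eq0 (negbTE S0) mulr0.
have P01 x : 0 <= x <= 1 -> 0 <= P.[x] <= 1.
  move=> /andP[x0 x1]; rewrite Px -sum_bernoulli_ev.
  have w0 (X : {set T}) : 0 <= \prod_i (if i \in X then x else 1 - x).
    by apply: prodr_ge0 => i _; case: ifP => // _; rewrite subr_ge0.
  apply/andP; split.
    by apply: sumr_ge0 => X _; apply: mulr_ge0 => //; case: (bc X) => ->.
  have sumw : \sum_(X : {set T}) \prod_i (if i \in X then x else 1 - x) = 1.
    rewrite -[LHS](bigA_distr _ _ (fun=> x) (fun=> 1 - x)).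
    by rewrite big1 // => i _ /=; rewrite addrC subrK.
  rewrite -[X in _ <= X]sumw; apply: ler_sum => X _.
  by case: (bc X) => ->; rewrite ?mulr0 ?mulr1.
have := markov_at0 sP P01 P0.
rewrite horner_coef0 coef_deriv mulr1n coef_sum.
have -> : \sum_(S : {set T}) (c S *: 'X^#|S|)`_1 = \sum_i c [set i].
  rewrite -sum_cards1 [RHS]big_mkcond; apply: eq_bigr => S _.
  by rewrite coefZ coefXn eq_sym; case: eqP; rewrite ?mulr1 ?mulr0.
under eq_bigr do rewrite ci.
rewrite -natr_sum -natrX ler_nat; apply: leq_trans.
by rewrite -sum1dep_card big_mkcond; apply: leq_sum => i _; case: ifP => // ->.
Qed.

(** An inclusion-minimal nonempty [A] inside [B] with [c A != 0] works: below it only the constant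
    term remains, so the two values differ by [c A]. *)
Lemma minimal_subcoef (R : realFieldType) (T : finType) (c : {set T} -> R) (B : {set T}) :
  B != set0 -> c B != 0 ->
  exists2 A : {set T}, (A != set0) && (A \subset B) & ev c A != ev c set0.
Proof.
move=> B0 cB; pose P (A : {set T}) := (A != set0) && (c A != 0).
have /minset_exists[A /minsetP[/andP[A0 cA] minA] AB] : P B by rewrite /P B0.
exists A; first by rewrite A0.
rewrite ev_set0 /ev (bigD1 set0) ?sub0set //= (bigD1 A) /= ?subxx ?A0 //.
rewrite big1 ?addr0 => [|S /andP[/andP[SA S0] SnA]].
  by rewrite addrC -subr_eq0 addrK.
by apply: contraNeq SnA => cS; rewrite (minA S) // /P S0.
Qed.

Lemma card_disjoint_monomials (R : realType) (T : finType) (c : {set T} -> R) d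
    (F : {set {set T}}) :
  bool_valued (ev c) -> coef_deg_le c d -> trivIset F ->
  (forall B : {set T}, B \in F -> B != set0 /\ c B != 0) -> (#|F| <= d ^ 2)%N.
Proof.
move=> bc cd tF Fc.
have /fin_all_exists[g gP] (B : {set T}) : exists A : {set T}, B \in F ->
    [/\ A != set0, A \subset B & ev c A != ev c set0].
  have [BF|] := boolP (B \in F); last by exists set0.
  have [B0 cB] := Fc _ BF; have [A /andP[A0 AB] evA] := minimal_subcoef B0 cB.
  by exists A.
(* The chosen block [g B] becomes the single variable [B]. All other points go to the dummy variable
   [set0], which is not in [F] and is kept at 0. *)
pose phi x := if x \in g (pblock F x) then pblock F x else set0.
have phi_pre0 : phi @^-1: set0 = set0.
  by apply/setP => x; rewrite !inE.
have phi_pre (B : {set T}) : B \in F -> phi @^-1: [set B] = g B.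
  move=> BF; have [_ gB _] := gP _ BF; have [B0 _] := Fc _ BF.
  apply/setP => x; rewrite !inE /phi; apply/idP/idP => [|xg].
    by case: ifP => [xg /eqP<-//|_]; rewrite eq_sym (negbTE B0).
  have xB : x \in B by apply: (subsetP gB).
  by rewrite (def_pblock tF BF xB) xg.
have bc' : bool_valued (ev (pushfwd phi c)) by move=> X; rewrite ev_pushfwd.
apply: leq_trans _ (card_sensitive_at0 bc' (pushfwd_deg cd)).
apply/subset_leq_card/subsetP => B BF; rewrite inE.
have [_ _ evB] := gP _ BF.
rewrite -[pushfwd _ _ _](addKr (pushfwd phi c set0)) -ev_set1 -ev_set0 !ev_pushfwd.
by rewrite phi_pre0 phi_pre // addrC subr_eq0.
Qed.

(** A monomial of degree [d] missing the union of a maximal disjoint family could be added to it.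
    Positivity of [d] makes these monomials nonempty, hence new to the family. *)
Lemma monomial_hitting_set (R : realType) (T : finType) (c : {set T} -> R) d :
  bool_valued (ev c) -> coef_deg_le c d -> (0 < d)%N ->
  exists H : {set T},
    [/\ (#|H| <= d ^ 3)%N,
        forall i, i \in H -> exists S : {set T}, [/\ i \in S, c S != 0 & #|S| = d]
      & forall S : {set T}, c S != 0 -> #|S| = d -> ~~ [disjoint S & H]].
Proof.
move=> bc cd d_gt0.
pose top (B : {set T}) := (c B != 0) && (#|B| == d).
pose P (F : {set {set T}}) := trivIset F && [forall B in F, top B].
have P0 : P set0.
  rewrite /P; apply/andP; split; first by apply/trivIsetP => A B; rewrite inE.
  by apply/forall_inP => B; rewrite inE.
have [F /maxsetP[/andP[tF /forall_inP Ftop] maxF] _] := maxset_exists P0.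
have topN0 B : top B -> B != set0.
  by case/andP => _ /eqP Bd; rewrite -card_gt0 Bd.
exists (cover F); split.
- rewrite (leq_trans (leq_card_cover F)) //.
  rewrite (eq_bigr (fun=> d)) => [|B /Ftop /andP[_ /eqP]//].
  rewrite sum_nat_const expnSr leq_mul2r; apply/orP; right.
  apply: (card_disjoint_monomials bc cd tF) => B /Ftop Bt; split; first exact: topN0.
  by case/andP: Bt.
- move=> i /bigcupP[B /Ftop /andP[cB /eqP Bd] iB]; by exists B.
move=> S cS Sd; apply/negP => dSF.
have St : top S by rewrite /top cS Sd eqxx.
have F0 : set0 \notin F by apply/negP => /Ftop /topN0; rewrite eqxx.
have dS : {in F, forall B : {set T}, [disjoint S & B]}.
  move=> B BF; apply: disjointWr dSF; exact: bigcup_sup.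
have [tSF SF] := trivIsetU1 dS tF F0.
case/negP: SF; rewrite -(maxF (S |: F)) ?setU11 ?subsetUr //.
rewrite /P tSF; apply/forall_inP => B; rewrite !inE => /orP[/eqP->//|]; exact: Ftop.
Qed.

(** * Lowering the degree, and the numerical constant *)

Lemma sum_wt_step (R : realType) (T : finType) (c : {set T} -> R) d (K : R) :
  bool_valued (ev c) -> coef_deg_le c d.+1 ->
  (forall c' : {set T} -> R, bool_valued (ev c') -> coef_deg_le c' d ->
     \sum_i wt c' i <= K) ->
  \sum_i wt c i <= K + d.+1%:R ^+ 3 * 2^-1 ^+ d.+1.
Proof.
move=> bc cd IH; have [H [cardH Htop hit]] := monomial_hitting_set bc cd (ltn0Sn d).
rewrite (bigID (fun i => i \in H)) /= addrC; apply: lerD.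
  pose g X := \sum_i wt (resseq (enum H) X c) i.
  apply: (@le_trans _ _ (mean g)).
    apply: (@le_trans _ _ (\sum_(i | i \notin H) mean (fun X => wt (resseq (enum H) X c) i))).
      by apply: ler_sum => i iH; apply: wt_resseq; rewrite ?enum_uniq ?mem_enum.
    rewrite -mean_sum; apply: le_mean => X; rewrite /g [X in _ <= X](bigID (fun i => i \in H)) /=.
    by rewrite lerDr; apply: sumr_ge0 => i _; apply: wt_ge0.
  rewrite -[X in _ <= X](mean_const T); apply: le_mean => X; apply: IH.
    exact: resseq_bool.
  (* A surviving [S] of full degree would equal the original monomial [S :|: B], which meets [H],
     whereas [S] avoids [H]. *)
  move=> S /resseq_neq0[SH [B [BH cSB]]].
  have sSB := subset_leq_card (subsetUl S B); have SBd := cd _ cSB.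
  rewrite -ltnS ltn_neqAle (leq_trans sSB SBd) andbT; apply/eqP => Sd.
  have SB : S = S :|: B by apply/eqP; rewrite eqEcard subsetUl Sd SBd.
  have := hit S; rewrite {1}SB => /(_ cSB Sd) /negP; apply.
  rewrite disjoint_sym disjoint_subset; apply/subsetP => x xH.
  by rewrite inE SH // mem_enum.
apply: (@le_trans _ _ (\sum_(i in H) 2^-1 ^+ d.+1)).
  apply: ler_sum => i iH; have [S [iS cS <-]] := Htop _ iH; exact: wt_le.
rewrite sumr_const -[_ *+ _]mulr_natl ler_wpM2r ?exprn_ge0 ?half_ge0 //.
by rewrite -natrX ler_nat.
Qed.

(* [d ^ 3 + 6 d ^ 2 + 18 d + 26] is [2 ^ d] times the tail [\sum_(k > d) k ^ 3 / 2 ^ k]; using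
   the bound [d / 2] up to degree [11] minimises the resulting constant. *)
Lemma sum_wt_bound (R : realType) (T : finType) (c : {set T} -> R) d :
  bool_valued (ev c) -> coef_deg_le c (d + 11) ->
  let m : R := (d + 11)%:R in
  \sum_i wt c i + (m ^+ 3 + 6 * m ^+ 2 + 18 * m + 26) * 2^-1 ^+ (d + 11) <=
  3307 / 500.
Proof.
elim: d c => [|d IH] c bc cd /=.
  have := sum_wt_le_half_deg bc cd.
  rewrite add0n; move: (\sum_i _) => w.
  have -> : 2^-1 ^+ 11 = 2048%:R^-1 :> R by rewrite exprVn -natrX.
  lra.
move: cd; rewrite addSn => cd; have := sum_wt_step bc cd.
rewrite -natr1; move: IH => /=; move: (d + 11)%:R => m IH step.
rewrite -lerBrDr.
apply: le_trans (step (3307 / 500 - (m ^+ 3 + 6 * m ^+ 2 + 18 * m + 26) * 2^-1 ^+ (d + 11)) _) _.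
  by move=> c' bc' cd'; rewrite lerBrDr; apply: IH.
(* The tail polynomial [p] satisfies [2 p(m) = (m + 1) ^ 3 + p(m + 1)], so the two sides are
   equal. *)
rewrite [2^-1 ^+ _.+1]exprSr; move: (2^-1 ^+ (d + 11)) => t.
by lra.
Qed.

(** * The doubling construction *)

(** If no toggle of [i] changes the value, the two restrictions of [i] agree as functions, hence in
    coefficients by [ev_inj], and every coefficient involving [i] is 0. *)
Lemma relvP (R : realFieldType) (T : finType) (c : {set T} -> R) i :
  reflect (exists X, ev c (i |: X) != ev c (X :\ i)) (relv c i).
Proof.
apply: (iffP idP) => [ci|[X]]; last first.
  apply: contraNT => ci; apply/eqP; apply: (@ev_off _ _ _ i) => [S iS|].
    exact: not_relv iS.
  by apply/setP => x; rewrite !inE; case: eqP.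
case: (boolP [exists X : {set T}, ev c (i |: X) != ev c (X :\ i)]) => [/existsP//|].
rewrite negb_exists => /forallP evE.
have resE : res i true c =1 res i false c.
  by apply: ev_inj => X; rewrite !ev_res; apply/eqP; rewrite -[_ == _]negbK.
have [S [iS cS _]] := vardegP ci.
have := resE (S :\ i); rewrite /res setD11 addr0 setD1K // => /eqP.
by rewrite -subr_eq0 addrC addKr (negbTE cS).
Qed.

(** Degree as a property of functions on the cube, so that it can be bounded through sums, products
    and substitutions. *)
Definition has_deg (R : realFieldType) (T : finType) (g : {set T} -> R) (d : nat) :=
  exists2 c, ev c =1 g & coef_deg_le c d.

Lemma has_deg_cst (R : realFieldType) (T : finType) (a : R) d :
  has_deg (fun _ : {set T} => a) d.
Proof.
exists (fun S => if S == set0 then a else 0) => [X|S].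
  rewrite /ev (bigD1 set0) ?sub0set //= eqxx big1 ?addr0 // => S /andP[_ S0].
  by rewrite (negbTE S0).
by have [->|S0] := eqVneq S set0; rewrite ?cards0 // eqxx.
Qed.

Lemma has_deg_mem (R : realFieldType) (T : finType) (i : T) :
  has_deg (fun X : {set T} => (i \in X)%:R : R) 1.
Proof.
exists (fun S => (S == [set i])%:R) => [X|S]; last first.
  by have [->|S0] := eqVneq S [set i]; rewrite ?cards1 // eqxx.
rewrite /ev -sub1set; have [iX|iX] := boolP ([set i] \subset X).
  rewrite (bigD1 [set i]) //= eqxx big1 ?addr0 // => S /andP[_ Si].
  by rewrite (negbTE Si).
rewrite big1 // => S SX; have [Si|//] := eqVneq S [set i].
by rewrite -Si SX in iX.
Qed.

Lemma has_degD (R : realFieldType) (T : finType) (g h : {set T} -> R) d :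
  has_deg g d -> has_deg h d -> has_deg (fun X => g X + h X) d.
Proof.
move=> [c evc cd] [c' evc' cd']; exists (fun S => c S + c' S) => [X|S].
  by rewrite -evc -evc' /ev big_split.
by have [->|/cd//] := eqVneq (c S) 0; rewrite add0r; apply: cd'.
Qed.

Lemma has_degM (R : realFieldType) (T : finType) (g h : {set T} -> R) d k :
  has_deg g d -> has_deg h k -> has_deg (fun X => g X * h X) (d + k).
Proof.
move=> [c evc cd] [c' evc' cd'].
exists (fun S => \sum_(p : {set T} * {set T} | p.1 :|: p.2 == S) c p.1 * c' p.2) => [X|S].
  rewrite -evc -evc' /ev big_distrlr pair_big /=.
  rewrite (exchange_big_dep (fun p : {set T} * {set T} => p.1 :|: p.2 \subset X)) /=.
    apply: eq_big => [p|p pX]; first by rewrite subUset.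
    rewrite (bigD1 (p.1 :|: p.2)) ?pX ?eqxx //= big1 ?addr0 // => S.
    by case/andP => /andP[_ /eqP->]; rewrite eqxx.
  by move=> S p SX /eqP->.
apply: contraR; rewrite -ltnNge => dS; rewrite big1 // => p /eqP pS.
have [->|/cd p1] := eqVneq (c p.1) 0; first by rewrite mul0r.
have [->|/cd' p2] := eqVneq (c' p.2) 0; first by rewrite mulr0.
by move: dS; rewrite -pS ltnNge (leq_trans (leq_card_setU _ _)) ?leq_add.
Qed.

Lemma has_deg_pre (R : realFieldType) (T U : finType) (phi : T -> U) (g : {set T} -> R) d :
  has_deg g d -> has_deg (fun X => g (phi @^-1: X)) d.
Proof.
move=> [c evc cd]; exists (pushfwd phi c); last exact: pushfwd_deg.
by move=> X; rewrite ev_pushfwd evc.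
Qed.

(* On signs, with [x], [y] the bits [inl false], [inl true] and [A], [B] two copies of [c] on
   disjoint variables: [(x A + y A + x B - y B) / 2]. *)
Definition doubling (R : realFieldType) (T : finType) (c : {set T} -> R)
    (X : {set bool + bool * T}) : R :=
  let f b := ev c [set t | inr (b, t) \in X] in
  let v := if (inl false \in X) == (inl true \in X) then f false else f true in
  if inl false \in X then 1 - v else v.

Lemma doubling_bool (R : realFieldType) (T : finType) (c : {set T} -> R) :
  bool_valued (ev c) -> bool_valued (doubling c).
Proof.
move=> bc X; rewrite /doubling.
have bN (v : R) : v = 0 \/ v = 1 -> 1 - v = 0 \/ 1 - v = 1.
  by case=> ->; rewrite ?subr0 ?subrr; [right|left].
by case: ifP => _; [apply: bN|]; case: ifP => _; apply: bc.
Qed.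

Lemma doubling_deg (R : realFieldType) (T : finType) (c : {set T} -> R) d :
  coef_deg_le c d -> has_deg (doubling c) d.+1.
Proof.
move=> cd; pose U : finType := (bool + bool * T)%type.
pose s (i : U) (X : {set U}) : R := 1 + - 2 * (i \in X)%:R.
pose f b (X : {set U}) : R := ev c ((fun t => inr (b, t)) @^-1: X).
have sdeg i : has_deg (s i) 1.
  apply: has_degD; first exact: has_deg_cst.
  by apply: (has_degM (d := 0)); [apply: has_deg_cst | apply: has_deg_mem].
have fdeg b : has_deg (f b) d.
  by apply: (@has_deg_pre _ _ _ (fun t => inr (b, t) : U) (ev c)); exists c.
have gdeg b : has_deg (fun X => 1 + - 2 * f b X) d.
  apply: has_degD; first exact: has_deg_cst.
  by apply: (has_degM (d := 0)); [apply: has_deg_cst | apply: fdeg].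
have Ndeg i : has_deg (fun X => - 1 * s i X) 1.
  by apply: (has_degM (d := 0)); [apply: has_deg_cst | apply: sdeg].
(* With signs [1 - 2 v] for bits [v], this is twice the sign of the result; the factor [- 4^-1] and
   the constant [2^-1] convert it back to a bit. *)
have := has_degD
  (has_degM (has_degD (sdeg (inl false)) (sdeg (inl true))) (gdeg false))
  (has_degM (has_degD (sdeg (inl false)) (Ndeg (inl true))) (gdeg true)).
move/(has_degM (has_deg_cst _ (- 4^-1) 0))/(has_degD (has_deg_cst _ 2^-1 (0 + (1 + d)))).
rewrite add0n add1n => -[c' evc' cd']; exists c' => // X; rewrite {}evc' /doubling /f /s.
have fE b : [set t | inr (b, t) \in X] = (fun t => inr (b, t)) @^-1: X.
  by apply/setP => t; rewrite !inE.
rewrite !fE; move: (ev c _) (ev c _) => a b.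
by case: (inl false \in X); case: (inl true \in X) => /=; field.
Qed.

Lemma doubling_relv (R : realFieldType) (T : finType) (c : {set T} -> R)
    (c' : {set bool + bool * T} -> R) :
  bool_valued (ev c) -> ev c' =1 doubling c -> (0 < #|[set i | relv c i]|)%N ->
  (2 * #|[set i | relv c i]| + 2 <= #|[set i | relv c' i]|)%N.
Proof.
move=> bc evc' /card_gt0P[t0]; rewrite inE => /relvP[X0 evX0].
pose U : finType := (bool + bool * T)%type.
have relx : relv c' (inl false).
  (* At 0 both copies take the same value, so toggling [inl false] only negates the result. *)
  apply/relvP; exists set0; rewrite !evc' /doubling !inE /=.
  have pre0 b (Y : {set U}) : Y \subset [set inl false] -> [set t | inr (b, t) \in Y] = set0.
    move=> /subsetP sY; apply/setP => t; rewrite !inE.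
    by apply/negP => /sY; rewrite inE.
  rewrite !pre0 ?subUset ?subxx ?sub0set //; last first.
    exact: subset_trans (subD1set _ _) (sub0set _).
  by case: (bc set0) => ->; rewrite ?subr0 ?subrr ?oner_eq0 // eq_sym oner_eq0.
have rely : relv c' (inl true).
  (* The two copies receive points where [c] differs, so toggling the selecting bit [inl true] is
     seen. *)
  pose Y : {set U} := [set i | match i with
    | inr (false, t) => t \in t0 |: X0 | inr (true, t) => t \in X0 :\ t0 | _ => false end].
  apply/relvP; exists Y; rewrite !evc' /doubling !inE /= eq_sym.
  have -> : [set t | inr (true, t) \in inl true |: Y] = X0 :\ t0.
    by apply/setP => t; rewrite !inE.
  have -> : [set t | inr (false, t) \in Y :\ inl true] = t0 |: X0.
    by apply/setP => t; rewrite !inE.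
  by [].
have rel2 b t : relv c t -> relv c' (inr (b, t)).
  move=> /relvP[X evX]; apply/relvP.
  (* With [inl false] at 0 and [inl true] equal to [b], copy [b] is selected and not negated. *)
  pose Y : {set U} := [set i | match i with
    | inr (_, t) => t \in X | inl b' => b && b' end].
  exists Y; rewrite !evc' /doubling !inE /= andbF andbT.
  have YU b' : b' = b -> [set t' | inr (b', t') \in inr (b, t) |: Y] = t |: X.
    move=> ->; apply/setP => t'.
    by rewrite !inE -[inr _ == inr _]/((b, t') == (b, t)) xpair_eqE eqxx.
  have YD b' : b' = b -> [set t' | inr (b', t') \in Y :\ inr (b, t)] = X :\ t.
    move=> ->; apply/setP => t'.
    by rewrite !inE -[inr _ == inr _]/((b, t') == (b, t)) xpair_eqE eqxx.
  by case: b @Y YU YD => Y YU YD /=; rewrite YU // YD.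
pose Z : {set U} := [set i | match i with inl _ => true | inr p => relv c p.2 end].
apply: (@leq_trans #|Z|); last first.
  apply/subset_leq_card/subsetP => -[[]|[b t]]; rewrite !inE //; exact: rel2.
rewrite -[#|Z|]sum1dep_card big_sumType /= addnC leq_add //.
  by rewrite sum1_card card_bool.
rewrite (eq_bigl (fun p : bool * T => p \in setX [set: bool] [set i | relv c i])).
  by rewrite sum1_card cardsX cardsT card_bool.
by move=> p; rewrite !inE.
Qed.

(** * Boolean functions and their number of relevant variables *)

Definition ones (n : nat) (x : {ffun 'I_n -> bool}) : {set 'I_n} := [set i | x i].

Lemma ones_surj (n : nat) (X : {set 'I_n}) : exists x, ones x = X.
Proof. by exists [ffun i => i \in X]; apply/setP => i; rewrite inE ffunE. Qed.

Lemma mlrepP (R : realType) (n : nat) (f : boolfun n) (c : {set 'I_n} -> R) :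
  mlrep f c <-> forall x, (f x)%:R = ev c (ones x).
Proof.
have evE (x : {ffun 'I_n -> bool}) :
    \sum_(S : {set 'I_n}) c S * \prod_(i in S) ((x i)%:R : R) = ev c (ones x).
  rewrite /ev [RHS]big_mkcond; apply: eq_bigr => S _.
  case: ifPn => [/subsetP Sx|/subsetPn[i iS]].
    by rewrite big1 ?mulr1 // => i /Sx; rewrite inE => ->.
  by rewrite inE => /negbTE xi; rewrite (bigD1 i) //= xi mul0r mulr0.
by split=> fc x; rewrite fc evE.
Qed.

Lemma mlrep_bool (R : realType) (n : nat) (f : boolfun n) (c : {set 'I_n} -> R) :
  mlrep f c -> bool_valued (ev c).
Proof.
move=> /mlrepP fc X; have [x <-] := ones_surj X.
by rewrite -fc; case: (f x); [right|left].
Qed.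

Lemma nrelE (R : realType) (n : nat) (f : boolfun n) (c : {set 'I_n} -> R) :
  mlrep f c -> nrel R f = #|[set i | relv c i]|.
Proof.
move=> fc; apply: eq_card => i; rewrite !inE; apply/asboolP/existsP.
  move=> [c' [fc' [S [iS cS]]]]; exists S; rewrite iS.
  suff -> : c S = c' S by [].
  apply: ev_inj => X; have [x <-] := ones_surj X.
  by rewrite -(mlrepP f c).1 // -(mlrepP f c').1.
by move=> [S /andP[iS cS]]; exists c; split=> //; exists S.
Qed.

(** Renames the variables along [enum_rank], so that examples over any finite type yield functions
    over some ['I_n]. *)
Lemma boolfun_of_coef (R : realType) (T : finType) (c : {set T} -> R) d :
  bool_valued (ev c) -> coef_deg_le c d ->
  exists n (f : boolfun n), deg_le R f d /\ nrel R f = #|[set i | relv c i]|.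
Proof.
move=> bc cd; pose c' := pushfwd (@enum_rank T) c.
pose f : boolfun #|T| := fun x => ev c' (ones x) == 1.
have fc' : mlrep f c'.
  apply/mlrepP => x; rewrite /f ev_pushfwd.
  by case: (bc (enum_rank @^-1: ones x)) => ->; rewrite ?eqxx // eq_sym oner_eq0.
exists #|T|, f; split; first by exists c'; split=> // S; apply: pushfwd_deg.
rewrite (nrelE fc') -(card_imset _ (@enum_rank_inj T)); apply: eq_card => i.
rewrite inE -[i]enum_valK mem_imset ?inE; last exact: enum_rank_inj.
have preU X : enum_rank @^-1: (enum_rank (enum_val i) |: X) = enum_val i |: enum_rank @^-1: X.
  by apply/setP => t; rewrite !inE (inj_eq enum_rank_inj).
have preD X : enum_rank @^-1: (X :\ enum_rank (enum_val i)) = (enum_rank @^-1: X) :\ enum_val i.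
  by apply/setP => t; rewrite !inE (inj_eq enum_rank_inj).
apply/relvP/relvP => [[X]|[X evX]].
  by rewrite !ev_pushfwd preU preD => evX; exists (enum_rank @^-1: X).
exists (enum_rank @: X); rewrite !ev_pushfwd preU preD.
suff -> : enum_rank @^-1: (enum_rank @: X) = X by [].
by apply/setP => t; rewrite inE mem_imset //; apply: enum_rank_inj.
Qed.

Lemma nrel_le_sum_wt (R : realType) (n : nat) (f : boolfun n) (c : {set 'I_n} -> R) d :
  mlrep f c -> coef_deg_le c d -> (nrel R f)%:R / 2 ^+ d <= \sum_i wt c i.
Proof.
move=> fc cd; rewrite (nrelE fc) -exprVn mulr_natl -sumr_const big_mkcond /=.
apply: ler_sum => i _; rewrite inE; case: ifP => [ci|_]; last exact: wt_ge0.
by apply: wt_ge => // S _; apply: cd.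
Qed.

(** * The numbers [R_d] and the limit of [R_d / 2 ^ d] *)

Lemma ex_Rd (R : realType) (d : nat) : exists r, is_Rd R d r.
Proof.
pose P r := `[< exists (n : nat) (f : boolfun n), deg_le R f d /\ nrel R f = r >].
have exP : exists r, P r.
  have bc : bool_valued (ev (fun _ : {set unit} => 0 : R)).
    by move=> X; left; apply: big1.
  have cd : coef_deg_le (fun _ : {set unit} => 0 : R) d by move=> S; rewrite eqxx.
  have [n [f [fd fr]]] := boolfun_of_coef bc cd.
  by exists (nrel R f); apply/asboolP; exists n, f.
(* The influence bound gives [d / 2 * 2 ^ d]; any finite bound makes the maximum exist. *)
have ubP r : P r -> (r <= d * 2 ^ d)%N.
  move=> /asboolP[n [f [[c [fc cd]] <-]]].
  have := le_trans (nrel_le_sum_wt fc cd) (sum_wt_le_half_deg (mlrep_bool fc) cd).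
  rewrite ler_pdivrMr ?exprn_gt0 // => le1.
  rewrite -(ler_nat R) natrM natrX (le_trans le1) // ler_wpM2r ?exprn_ge0 //.
  by rewrite ler_pdivrMr // ler_peMr // ler1n.
have [r /asboolP Pr maxr] := ex_maxnP exP ubP.
exists r; split=> // n f fd; apply: maxr; apply/asboolP; by exists n, f.
Qed.

Lemma Rd_ratio_le (R : realType) (d r : nat) : is_Rd R (d + 11) r ->
  r%:R / 2 ^+ (d + 11) <= 3307 / 500 :> R.
Proof.
move=> [[n [f [[c [fc cd]] <-]]] _]; apply: le_trans (nrel_le_sum_wt fc cd) _.
apply: le_trans (sum_wt_bound (mlrep_bool fc) cd); rewrite /= lerDl.
by rewrite mulr_ge0 ?exprn_ge0 ?half_ge0 // !addr_ge0 ?mulr_ge0 ?exprn_ge0.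
Qed.

Lemma Rd1_gt0 (R : realType) (r : nat) : is_Rd R 1 r -> (0 < r)%N.
Proof.
move=> [_ maxr]; have [c evc cd] := @has_deg_mem R unit tt.
have bc : bool_valued (ev c).
  by move=> X; rewrite evc; case: (tt \in X); [right|left].
have [n [f [fd fr]]] := boolfun_of_coef bc cd.
apply: leq_trans (maxr _ _ fd); rewrite fr; apply/card_gt0P; exists tt; rewrite inE.
by apply/relvP; exists set0; rewrite !evc !inE oner_eq0.
Qed.

Lemma Rd_doubling (R : realType) (d r r' : nat) : is_Rd R d r -> is_Rd R d.+1 r' ->
  (0 < r)%N -> (2 * r + 2 <= r')%N.
Proof.
move=> [[n [f [[c [fc cd]] fr]]] _] [_ maxr'] r_gt0.
have bc := mlrep_bool fc; rewrite (nrelE fc) in fr.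
have [c' evc' cd'] := doubling_deg cd.
have bc' : bool_valued (ev c') by move=> X; rewrite evc'; apply: doubling_bool.
have [m [g [gd gr]]] := boolfun_of_coef bc' cd'.
apply: leq_trans (maxr' _ _ gd); rewrite gr -fr; apply: doubling_relv evc' _ => //.
by rewrite fr.
Qed.

Local Open Scope classical_set_scope.
Local Open Scope ring_scope.

Theorem theorem2 (R : realType) :
  exists Rd : nat -> nat, (forall d, is_Rd R d (Rd d)) /\
  exists Cstar : R,
    ((fun d : nat => ((Rd d)%:R / 2%:R ^+ d : R)) @ \oo --> Cstar) /\
    3%:R / 2%:R <= Cstar /\ Cstar <= 6614%:R / 1000%:R.
Proof.
have [Rd RdP] := choice (ex_Rd R).
exists Rd; split=> //.
pose u d : R := (Rd d)%:R / 2 ^+ d.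
have u_le_next d : u d <= u d.+1.
  rewrite /u ler_pdivrMr ?exprn_gt0 // mulrAC ler_pdivlMr ?exprn_gt0 // exprS mulrA.
  rewrite ler_wpM2r ?exprn_ge0 // -natrM ler_nat mulnC.
  have [->|] := posnP (Rd d); first by rewrite muln0.
  by move=> /(Rd_doubling (RdP d) (RdP d.+1)); apply: leq_trans; rewrite leq_addr.
have u_nd : nondecreasing_seq u by apply/nondecreasing_seqP.
have u_le d : u d <= 3307 / 500.
  (* Monotonicity carries the bound from index [d + 11] back to [d]. *)
  by apply: le_trans (u_nd _ _ (leq_addr 11 d)) _; apply: Rd_ratio_le.
have u_cvg : cvgn u.
  apply: nondecreasing_is_cvgn => //; exists (3307 / 500) => _ [d _ <-]; exact: u_le.
exists (limn u); split; first exact: u_cvg.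
(* Doubling from [R_1 >= 1] gives [R_(d+1) >= 3 * 2 ^ d - 2], that is
   [u d.+1 >= 3 / 2 - 2 ^ - d]. *)
have Rd_ge d : (3 * 2 ^ d <= Rd d.+1 + 2)%N.
  elim: d => [|d IH]; first by have := Rd1_gt0 (RdP 1%N); lia.
  have Rd_gt0 : (0 < Rd d.+1)%N by have := expn_gt0 2 d; lia.
  by have := Rd_doubling (RdP d.+1) (RdP d.+2) Rd_gt0; rewrite expnS; lia.
split; last first.
  apply: (@le_trans _ _ (3307 / 500)).
    by apply: limr_le => //; apply: nearW.
  have double_frac a b : a%:R / b%:R = (a * 2)%N%:R / (b * 2)%N%:R :> R.
    by rewrite !natrM -mulf_div divff ?mulr1 ?pnatr_eq0.
  rewrite (double_frac 3307%N 500%N).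
  have -> : (3307 * 2)%N = 6614%N by vm_compute.
  by have -> : (500 * 2)%N = 1000%N by vm_compute.
have lb_cvg : (fun d => 3 / 2 - (2^-1 : R) ^+ d) @ \oo --> 3 / 2 - (0 : R).
  apply: cvgB; first exact: cvg_cst.
  by apply: cvg_expr; rewrite ger0_norm; lra.
have u_cvgS : (fun d => u d.+1) @ \oo --> limn u by move: u_cvg; rewrite -cvg_shiftS.
rewrite -[X in X <= _]subr0; apply: ler_cvg_to lb_cvg u_cvgS _.
apply: nearW => d.
rewrite /u ler_pdivlMr ?exprn_gt0 // mulrBl exprS exprVn.
have := Rd_ge d; rewrite -(ler_nat R) natrM natrD natrX => H.
have : (2 : R) ^+ d != 0 by rewrite expf_neq0.
move: ((2 : R) ^+ d) H => x H x0.
by rewrite [x^-1 * _]mulrCA mulVf // mulr1; lra.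
Qed.
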